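(* Let $X$ be a set, let $\mathcal{A}$ be an algebra of subsets of $X$, and let $m\colon\mathcal{A}\to[0,\infty]$ be a measure on $\mathcal{A}$, with corresponding outer measure $m^*$. Define $$\mathcal{M}:=\{E\subseteq X\colon \forall A\in\mathcal{A}_{\mathsf{fin}}\ \forall\varepsilon>0\ \exists B\in\mathcal{A}\ \ d_A(E,B)<\varepsilon\},$$ $$\mathcal{M}_{\mathsf{Ca}}:=\{E\subseteq X\colon m^*(F)=m^*(F\cap E)+m^*(F\cap E^{\mathsf{c}})\ \ \forall F\subseteq X\},$$ $$\mathcal{M}_{\mathsf{Ca},\mathcal{A}_{\mathsf{fin}}}:=\{E\subseteq X\colon m^*(A)=m^*(A\cap E)+m^*(A\cap E^{\mathsf{c}})\ \ \forall A\in\mathcal{A}_{\mathsf{fin}}\},$$ $$\mathcal{M}_{\mathsf{Co}}:=\{E\subseteq X\colon \exists S\in\sigma(\mathcal{A})\ \ d_X(E,S)=0\},$$ $$\mathcal{M}_{\mathsf{Co},\mathcal{A}_{\mathsf{fin}}}:=\{E\subseteq X\colon \forall A\in\mathcal{A}_{\mathsf{fin}}\ \exists S\in\sigma(\mathcal{A})\ \ d_A(E,S)=0\}.$$ Then $$\mathcal{M}_{\mathsf{Co}}\subseteq\mathcal{M}_{\mathsf{Co},\mathcal{A}_{\mathsf{fin}}}=\mathcal{M}=\mathcal{M}_{\mathsf{Ca}}=\mathcal{M}_{\mathsf{Ca},\mathcal{A}_{\mathsf{fin}}}.$$ If the measure $m$ on $\mathcal{A}$ is $\sigma$-finite, then 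$$\mathcal{M}_{\mathsf{Co}}=\mathcal{M}_{\mathsf{Co},\mathcal{A}_{\mathsf{fin}}}=\mathcal{M}=\mathcal{M}_{\mathsf{Ca}}=\mathcal{M}_{\mathsf{Ca},\mathcal{A}_{\mathsf{fin}}}.$$
   Context: A measure on an algebra $\mathcal{A}$ over $X$ is a nonnegative function $m\colon\mathcal{A}\to[0,\infty]$ with $m(\emptyset)=0$ that is $\sigma$-additive: $m(\bigcup_n A_n)=\sum_n m(A_n)$ for every disjoint sequence $(A_n)$ in $\mathcal{A}$ with $\bigcup_n A_n\in\mathcal{A}$. Set $\mathcal{A}_{\mathsf{fin}}:=\{A\in\mathcal{A}\colon m(A)<\infty\}$. The measure $m$ is $\sigma$-finite on $\mathcal{A}$ if there is a disjoint sequence $(D_n)$ in $\mathcal{A}_{\mathsf{fin}}$ with $\bigcup_n D_n=X$. The outer measure corresponding to $m$ is defined for all $E\subseteq X$ by $m^*(E):=\inf\{\sum_{n=1}^\infty m(A_n)\colon (A_n)_{n=1}^\infty \text{ a sequence in }\mathcal{A},\ \bigcup_n A_n\supseteq E\}$. For $E,F\subseteq X$, $E+F$ denotes the symmetric difference of $E$ and $F$, and $E^{\mathsf{c}}:=X\setminus E$. For $A\in\mathcal{A}$ and $E,F\subseteq X$, $d_A(E,F):=m^*\big(A\cap(E+F)\big)$; in particular $d_X(E,F)=m^*(E+F)$. $\sigma(\mathcal{A})$ denotes the $\sigma$-algebra over $X$ generated by $\mathcal{A}$. *)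

(* Defs.v *)
From mathcomp Require Import all_boot all_order all_algebra.
From mathcomp Require Import all_classical all_reals all_analysis.

Set Implicit Arguments.
Unset Strict Implicit.
Unset Printing Implicit Defensive.

Import Order.TTheory GRing.Theory Num.Theory.

Local Open Scope classical_set_scope.
Local Open Scope ring_scope.
Local Open Scope ereal_scope.

(* [algebraOfSetsType] and [{measure set T -> \bar R}] force the carrier to be
   pointed.  Here X may be empty, so the algebra is a set of subsets of a bare
   type, and a measure on it is a function on all of [set X] of which only the
   values on the algebra are constrained (or ever used).  The last two lemmas
   of the file compare this with the library. *)

Section algebra_measure.
Context (R : realType) (X : Type).
Variables (A : set (set X)) (m : set X -> \bar R).

Definition algebra_of_sets := [/\ A set0, setU_closed A & setC_closed A].

Definition measure_on := [/\ m set0 = 0,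
  (forall B, A B -> 0 <= m B) &
  (forall F : (set X)^nat, (forall n, A (F n)) -> trivIset setT F ->
    A (\bigcup_n F n) -> m (\bigcup_n F n) = \sum_(n <oo) m (F n))].

Definition finite_part : set (set X) := [set B | A B /\ m B < +oo].

(* Unlike the library's [sigma_finite], this asks for a disjoint sequence. *)
Definition sigma_finite_on := exists D : (set X)^nat,
  [/\ (forall n, finite_part (D n)), trivIset setT D & \bigcup_n D n = setT].

Definition outer_ext (E : set X) : \bar R :=
  ereal_inf [set \sum_(n <oo) m (F n) | F in
    [set F : (set X)^nat | (forall n, A (F n)) /\ E `<=` \bigcup_n F n]].

Definition ext_dist (B E F : set X) : \bar R := outer_ext (B `&` (E `+` F)).

Definition approx_measurable : set (set X) :=
  [set E | forall B, finite_part B -> forall e : R, (0 < e)%R ->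
    exists2 C, A C & ext_dist B E C < e%:E].

Definition cara_measurable : set (set X) := outer_ext.-caratheodory.

Definition cara_measurable_fin : set (set X) :=
  [set E | forall B, finite_part B ->
    outer_ext B = outer_ext (B `&` E) + outer_ext (B `&` ~` E)].

Definition completion_measurable : set (set X) :=
  [set E | exists2 S, <<s A >> S & ext_dist setT E S = 0].

Definition completion_measurable_fin : set (set X) :=
  [set E | forall B, finite_part B ->
    exists2 S, <<s A >> S & ext_dist B E S = 0].

End algebra_measure.

Lemma outer_extE d (T : semiRingOfSetsType d) (R : realType)
    (mu : set T -> \bar R) : outer_ext d.-measurable mu = mu_ext mu.
Proof. by []. Qed.

Lemma measure_on_measurable d (T : algebraOfSetsType d) (R : realType)
    (mu : {measure set T -> \bar R}) :
  algebra_of_sets (d.-measurable : set (set T)) /\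
  measure_on d.-measurable mu.
Proof.
split; first by split; [exact: measurable0|exact: measurableU|exact: measurableC].
split; [exact: measure0|by move=> B _; exact: measure_ge0|].
by move=> F mF tF mUF; exact: measure_semi_bigcup.
Qed.

(* Main.v *)
Require Import Defs.
From mathcomp Require Import all_boot all_order all_algebra.
From mathcomp Require Import all_classical all_reals all_analysis.
From HB Require Import structures.

(** Write m* for the outer measure of m.  All the inclusions rest on one
    criterion, [caratheodory_of_finite_part]: to split every subset of X
    additively, a set E only has to satisfy
    m*(B & E) + m*(B \ E) <= m(B) for the B of finite measure in the algebra.
    This holds because the value of m* at a set Y of finite outer measure is
    nearly attained by a cover of Y by such B, and the inequalities for these B
    add up to the one for Y.  The criterion applies to the members of the
    algebra by finite additivity of m, so that the sigma-algebra which they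
    generate consists of Caratheodory measurable sets; it also shows that
    testing Caratheodory's condition on the finite part of the algebra is
    enough.

    If B has finite measure and E differs on B, up to outer measure d, from a
    Caratheodory measurable set S, then E splits B up to an error 2d, because S
    splits it exactly ([split_le_of_ext_dist]).  For S in the algebra and d
    arbitrarily small, or S in the generated sigma-algebra and d = 0, this
    shows that the approximable sets and the local completion are contained in
    the Caratheodory class.

    Conversely let E be Caratheodory measurable.  A nearly optimal cover U of
    B & E by a sequence in the algebra exceeds E on B by a set of small outer
    measure only, since E splits B & U additively ([cara_outer_approx]).
    Cutting the sequence off after finitely many terms gives an approximation
    of E from the algebra, the error being the tail of a convergent series;
    intersecting such covers U for a sequence of errors tending to 0 gives a
    set of the sigma-algebra that differs from E on B by a null set.

    In the sigma-finite case the sets of the sigma-algebra obtained on the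
    pieces of a decomposition of X are glued along the pieces, and countably
    many null sets form a null set. *)

Import Order.TTheory GRing.Theory Num.Theory.

Local Open Scope classical_set_scope.
Local Open Scope ereal_scope.

(** * Series and generated sigma-algebras *)

Lemma nneseries_uncurry {R : realType} (f : nat -> nat * nat)
    (a : nat -> nat -> \bar R) :
  set_bij setT setT f -> (forall i j, 0 <= a i j) ->
  \sum_(i <oo) \sum_(j <oo) a i j = \sum_(k <oo) a (f k).1 (f k).2.
Proof.
move=> fbij a0; have suma0 i : 0 <= \sum_(j <oo) a i j.
  by apply: nneseries_ge0 => j _ _; exact: a0.
rewrite !nneseries_esumT// -(reindex_esum _ _ f (fun p => a p.1 p.2) fbij).
rewrite -[[set: nat * nat]](_ : setT `*`` (fun=> setT) = _); last first.
  by apply/seteqP; split.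
rewrite -(@esum_esum _ _ _ _ _ a)//.
by apply: eq_esum => i _; rewrite nneseries_esumT.
Qed.

Section sigma_closure.
Context (X : Type) (A : set (set X)).
Implicit Types (S : set X) (F : (set X)^nat).

Lemma sigma_setC S : <<s A >> S -> <<s A >> (~` S).
Proof. by rewrite -setTD; exact: sigma_algebraCD. Qed.

Lemma sigma_bigcap F : (forall n, <<s A >> (F n)) -> <<s A >> (\bigcap_n F n).
Proof.
move=> AF; rewrite -[\bigcap_n _]setCK setC_bigcap.
apply: sigma_setC; apply: sigma_algebra_bigcup => n.
exact: sigma_setC.
Qed.

Lemma sigma_setI S S' : <<s A >> S -> <<s A >> S' -> <<s A >> (S `&` S').
Proof.
move=> AS AS'; rewrite -bigcap2E; apply: sigma_bigcap.
case=> [|[|n]] //=; rewrite -[X in <<s A >> X]setC0.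
by apply: sigma_setC; exact: sigma_algebra0.
Qed.

End sigma_closure.

(** * Measures on an algebra *)

Section outer_measure_of_algebra.
Context (R : realType) (X : Type) (A : set (set X)) (m : set X -> \bar R).
Hypotheses (hA : algebra_of_sets A) (hm : measure_on A m).
Implicit Types (B C E S : set X) (F : (set X)^nat).

Local Notation mu := (outer_ext A m).

Lemma algebra_setI B C : A B -> A C -> A (B `&` C).
Proof.
case: hA => _ AU AC AB ACC; rewrite -[_ `&` _]setCK setCI.
by apply/AC/AU; exact: AC.
Qed.

Lemma algebra_bigsetU F n : (forall k, A (F k)) ->
  A (\big[setU/set0]_(i < n) F i).
Proof. by case: hA => A0 AU _ AF; elim/big_ind : _. Qed.

Lemma measure_on0 : m set0 = 0. Proof. by case: hm. Qed.

Lemma measure_on_ge0 B : A B -> 0 <= m B.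
Proof. by case: hm => _ + _; exact. Qed.

Lemma nneseries_bigcup2 B C : A B -> A C ->
  \sum_(n <oo) m (bigcup2 B C n) = m B + m C.
Proof.
move=> AB AC.
have m_ge0 n : 0 <= m (bigcup2 B C n).
  by case: n => [|[|n]] /=; rewrite ?measure_on0 ?measure_on_ge0.
rewrite (nneseries_split 0 2); last by move=> k _; exact: m_ge0.
rewrite /index_iota /= big_cons big_seq1 eseries0 ?adde0//=.
by move=> [|[|k]] //= _ _; exact: measure_on0.
Qed.

Lemma measure_onU B C : A B -> A C -> B `&` C = set0 ->
  m (B `|` C) = m B + m C.
Proof.
case: hA => A0 AU _ AB AC BC0; case: hm => _ _ madd.
rewrite -bigcup2E madd ?nneseries_bigcup2//.
- by case=> [|[|n]].
- by rewrite -trivIset_bigcup2.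
- by rewrite bigcup2E; exact: AU.
Qed.

(** * The outer measure of a measure on an algebra *)

Lemma outer_ext_le_cover E F : (forall n, A (F n)) ->
  E `<=` \bigcup_n F n -> mu E <= \sum_(n <oo) m (F n).
Proof. by move=> AF EF; apply: ereal_inf_lbound; exists F. Qed.

Lemma outer_ext_le B : A B -> mu B <= m B.
Proof.
have A0 : A set0 by case: hA.
move=> AB; rewrite -[leRHS]adde0 -measure_on0 -nneseries_bigcup2//.
by apply: outer_ext_le_cover; [case=> [|[|n]]|rewrite bigcup2E setU0].
Qed.

Lemma outer_ext_ge0 E : 0 <= mu E.
Proof.
apply: le_ereal_inf_tmp => _ [F [AF _] <-].
by apply: nneseries_ge0 => n _ _; exact: measure_on_ge0.
Qed.

Lemma outer_ext0 : mu set0 = 0.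
Proof.
apply/eqP; rewrite eq_le outer_ext_ge0 andbT -measure_on0.
by apply: outer_ext_le; case: hA.
Qed.

Lemma le_outer_ext : {homo mu : E E' / E `<=` E' >-> E <= E'}.
Proof.
move=> E E' EE'; apply: le_ereal_inf_tmp => _ [F [AF EF] <-].
by apply: outer_ext_le_cover => //; exact: subset_trans EF.
Qed.

Lemma outer_ext_adherent E (e : R) : mu E < +oo -> (0 < e)%R ->
  exists F, [/\ forall n, A (F n), E `<=` \bigcup_n F n &
                \sum_(n <oo) m (F n) < mu E + e%:E].
Proof.
move=> Eoo e0.
have Efin : mu E \is a fin_num by rewrite ge0_fin_numE ?outer_ext_ge0.
by have [_ [F [AF EF] <-] ?] := lb_ereal_inf_adherent e0 Efin; exists F.
Qed.

(** Cover the n-th set with excess at most e / 2 ^ (n + 1); the covering sets,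
    indexed by pairs of naturals, form a single sequence that covers the union
    with total excess at most e. *)
Lemma outer_ext_sigma_subadditive : sigma_subadditive mu.
Proof.
move=> E; have [[i Eioo]|] := pselect (exists i, mu (E i) = +oo).
  rewrite (eseries_pinfty _ _ Eioo) ?leey// => n _.
  by rewrite -ltNye (lt_le_trans _ (outer_ext_ge0 _)).
move=> /forallNP Eoo; apply/lee_addgt0Pr => e e0.
apply: le_trans (epsilon_trick predT (fun n => outer_ext_ge0 (E n)) (ltW e0)).
have /choice[G GE] n : exists F, [/\ forall k, A (F k), E n `<=` \bigcup_k F k &
    \sum_(k <oo) m (F k) < mu (E n) + (e / (2 ^ n.+1)%:R)%:E].
  apply: outer_ext_adherent; first by rewrite ltey; exact/eqP/Eoo.
  by rewrite divr_gt0// ltr0n expn_gt0.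
have AG n k : A (G n k) by have [] := GE n.
have /card_esym/ppcard_eqP[f] := card_nat2.
apply: (@le_trans _ _ (\sum_(n <oo) \sum_(k <oo) m (G n k))); last first.
  apply: lee_nneseries => n _; last by have [_ _ /ltW] := GE n.
  by move=> _; apply: nneseries_ge0 => k _ _; exact: measure_on_ge0.
rewrite (nneseries_uncurry f); [|exact: bij|by move=> *; exact: measure_on_ge0].
apply: outer_ext_le_cover => [j|x [n _ Ex]]; first exact: AG.
have [_ EG _] := GE n; have [k _ Gx] := EG _ Ex.
by exists (f^-1%FUN (n, k)) => //=; rewrite invK ?inE.
Qed.

HB.instance Definition _ := isOuterMeasure.Build R X mu
  outer_ext0 outer_ext_ge0 le_outer_ext outer_ext_sigma_subadditive.

(** * Caratheodory measurability *)

(** The bound is m(B) because this is the term that B contributes to the sum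
    of a cover.  As m*(B) <= m(B), it follows from Caratheodory's condition at
    B, and for E in the algebra from finite additivity of m. *)
Lemma caratheodory_of_finite_part E :
  (forall B, finite_part A m B -> mu (B `&` E) + mu (B `&` ~` E) <= m B) ->
  mu.-caratheodory E.
Proof.
move=> EB; apply: le_caratheodory_measurable => Y /=.
have [Yoo|] := ltP (mu Y) +oo; last by rewrite leye_eq => /eqP ->; exact: leey.
apply/lee_addgt0Pr => e e0.
have [F [AF YF Fe]] := outer_ext_adherent Y e Yoo e0.
apply: le_trans (ltW Fe).
(* A single term is bounded by the sum of the nonnegative series. *)
have Ffin n : finite_part A m (F n).
  split=> //; apply: le_lt_trans (_ : \sum_(n <oo) m (F n) < +oo); last first.
    by rewrite (lt_trans Fe)// lte_add_pinfty ?ltry.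
  rewrite (nneseriesD1 (n := n))//; last by move=> k _; exact: measure_on_ge0.
  by rewrite leeDl// nneseries_ge0// => k _ _; exact: measure_on_ge0.
apply: (@le_trans _ _ (\sum_(n <oo) mu (F n `&` E) +
                       \sum_(n <oo) mu (F n `&` ~` E))).
  by apply: leeD; apply: le_trans (outer_ext_sigma_subadditive _);
    apply: le_outer_ext; rewrite -setI_bigcupl; exact: setSI.
rewrite -nneseriesD; [|by move=> *; exact: outer_ext_ge0..].
apply: lee_nneseries => n _; last exact/EB/Ffin.
by move=> _; rewrite adde_ge0 ?outer_ext_ge0.
Qed.

Lemma algebra_caratheodory : A `<=` mu.-caratheodory.
Proof.
move=> B AB; apply: caratheodory_of_finite_part => C [AC _].
have AnB : A (~` B) by case: hA => _ _; exact.
have [ACB ACnB] := (algebra_setI _ _ AC AB, algebra_setI _ _ AC AnB).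
have -> : m C = m (C `&` B) + m (C `&` ~` B).
  rewrite -measure_onU//; last by rewrite setIACA setICr setI0.
  by rewrite -setIUr setUCr setIT.
by apply: leeD; exact: outer_ext_le.
Qed.

(** The Caratheodory measurable sets form a sigma-algebra. *)
Lemma sigma_caratheodory : <<s A >> `<=` mu.-caratheodory.
Proof.
apply: smallest_sub algebra_caratheodory; split.
- exact: caratheodory_measurable_set0.
- by move=> B MB; rewrite setTD; exact: caratheodory_measurable_setC.
- exact: caratheodory_measurable_bigcup.
Qed.

Lemma cara_measurable_finE : cara_measurable A m = cara_measurable_fin A m.
Proof.
apply/seteqP; split=> E ME; first by move=> B _; exact: ME.
by apply: caratheodory_of_finite_part => B Bfin; rewrite -ME// outer_ext_le//;
  case: Bfin.
Qed.

(** Both B & E and B \ E exceed the corresponding pieces cut out by S by a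
    subset of B & (E + S), whence the error d twice. *)
Lemma split_le_of_ext_dist B E S (d : \bar R) : mu.-caratheodory S ->
  ext_dist A m B E S <= d -> mu (B `&` E) + mu (B `&` ~` E) <= mu B + (d + d).
Proof.
move=> MS dES; rewrite (MS B) addeACA.
have le D D' : D `<=` D' `|` B `&` (E `+` S) -> mu D <= mu D' + d.
  move=> DD'; apply: le_trans (leeD2l _ dES).
  by apply: le_trans (outer_measureU2 _ _ _); exact: le_outer_ext.
by apply: leeD; apply: le => x [Bx Ex]; have [Sx|nSx] := pselect (S x);
  [left|right|right|left]; split => //; [left|right].
Qed.

(** * Comparison of the five classes *)

Lemma approx_sub_cara_fin : approx_measurable A m `<=` cara_measurable_fin A m.
Proof.
move=> E ME B Bfin; apply/eqP; rewrite eq_le le_outer_measureIC/=.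
apply/lee_addgt0Pr => e e0; have e20 : (0 < e / 2)%R by rewrite divr_gt0.
have [C AC /ltW EC] := ME B Bfin _ e20.
apply: le_trans (split_le_of_ext_dist B E C _ _ EC) _.
  exact: algebra_caratheodory.
by rewrite -EFinD -splitr.
Qed.

(** This is [split_le_of_ext_dist] with d = 0. *)
Lemma completion_fin_sub_cara_fin :
  completion_measurable_fin A m `<=` cara_measurable_fin A m.
Proof.
move=> E ME B Bfin; apply/eqP; rewrite eq_le le_outer_measureIC/=.
have [S AS ES0] := ME B Bfin; rewrite -[leRHS]adde0 -[X in _ + X]adde0.
apply: (split_le_of_ext_dist _ _ S); last by rewrite ES0.
exact: sigma_caratheodory.
Qed.

(** Caratheodory's condition for E at B & U, with U the union of a nearly
    optimal cover of B & E, reads m*(B & U) = m*(B & E) + m*(B & U \ E).  The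
    left-hand side is at most m*(B & E) + e, and the finite term m*(B & E)
    cancels. *)
Lemma cara_outer_approx E B (e : R) : mu.-caratheodory E ->
  finite_part A m B -> (0 < e)%R ->
  exists F, [/\ forall n, A (F n), B `&` E `<=` \bigcup_n F n,
    \sum_(n <oo) m (F n) < +oo & mu (B `&` (\bigcup_n F n) `&` ~` E) < e%:E].
Proof.
move=> ME [AB mB] e0.
have BEoo : mu (B `&` E) < +oo.
  apply: le_lt_trans mB; apply: le_trans (outer_ext_le _ AB).
  by apply: le_outer_ext; exact: subIsetl.
have [F [AF BEF Fe]] := outer_ext_adherent _ e BEoo e0.
exists F; split=> //; first by rewrite (lt_trans Fe)// lte_add_pinfty ?ltry.
have BEfin : mu (B `&` E) \is a fin_num by rewrite ge0_fin_numE ?outer_ext_ge0.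
rewrite -(@lteD2lE _ (mu (B `&` E)))//; apply: le_lt_trans Fe.
apply: (le_trans _ (outer_ext_le_cover _ F AF (@subIsetr _ B _))).
rewrite [leRHS](ME (B `&` _)) leeD2r// le_outer_ext// => x [Bx Ex]; split => //.
by split => //; exact: BEF.
Qed.

(** On B, the union C of the first N sets of the cover misses points of E only
    inside the remaining sets, and exceeds E only where the whole cover
    does. *)
Lemma cara_sub_approx : cara_measurable A m `<=` approx_measurable A m.
Proof.
move=> E ME B Bfin e e0; have e20 : (0 < e / 2)%R by rewrite divr_gt0.
have [F [AF BEF Foo Fe]] := cara_outer_approx E B _ ME Bfin e20.
have F0 n : 0 <= m (F n) by exact: measure_on_ge0.
have := @nneseries_tail_cvg _ (m \o F) xpredT Foo (fun n _ => F0 n).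
have e2E : 0 < (e / 2)%:E by rewrite lte_fin.
move=> /(_ _ (open_ereal_lt' e2E))[N _ /(_ N (leqnn N))/= FN].
exists (\big[setU/set0]_(i < N) F i); first exact: algebra_bigsetU.
rewrite [e in _ < e%:E]splitr EFinD; apply: le_lt_trans (lteD Fe FN).
apply: (@le_trans _ _ (mu (B `&` (\bigcup_n F n) `&` ~` E) +
                       mu (\bigcup_(n in ~` `I_N) F n))); last first.
  apply: leeD2l; apply: le_trans (outer_measure_sigma_subadditive_tail _ _ _) _.
  by apply: lee_nneseries => n _; [rewrite outer_ext_ge0|exact: outer_ext_le].
apply: le_trans (outer_measureU2 _ _ _); apply: le_outer_ext.
rewrite -bigcup_mkord => x [Bx [[Ex nFx]|[[n _ Fx] nEx]]]; last first.
  by left; split=> //; split=> //; exists n.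
have [n _ Fx] := BEF _ (conj Bx Ex); right; exists n => //= nN.
by apply: nFx; exists n.
Qed.

(** The intersection of the covers of B & E with excess 1 / (k + 1) contains
    B & E, and its excess over E on B is below every 1 / (k + 1). *)
Lemma cara_sub_completion_fin :
  cara_measurable A m `<=` completion_measurable_fin A m.
Proof.
move=> E ME B Bfin.
have k1_gt0 k : (0 < k.+1%:R^-1 :> R)%R by rewrite invr_gt0.
have /choice[G GE] k := cara_outer_approx E B _ ME Bfin (k1_gt0 k).
exists (\bigcap_k \bigcup_n G k n).
  apply: sigma_bigcap => k.
  apply: sigma_algebra_bigcup => n; apply: sub_sigma_algebra.
  by have [] := GE k.
apply/eqP; rewrite eq_le outer_ext_ge0 andbT; apply/lee_addgt0Pr => e e0.
rewrite add0e.
have [k ke] : exists k : nat, (k.+1%:R^-1 <= e)%R.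
  have [k _ /(_ k (leqnn k))/= ke] := near_infty_natSinv_lt (PosNum e0).
  by exists k; exact: ltW.
have [_ _ _ Gk] := GE k.
apply: (le_trans _ (le_trans (ltW Gk) _)); last by rewrite lee_fin.
apply: le_outer_ext => x [Bx [[Ex nGx]|[Gx nEx]]]; last first.
  by split=> //; split=> //; exact: Gx.
by case: nGx => j _; have [_ + _ _] := GE j; exact.
Qed.

Lemma completion_sub_completion_fin :
  completion_measurable A m `<=` completion_measurable_fin A m.
Proof.
move=> E [S AS ES0] B _; exists S => //.
apply/eqP; rewrite eq_le outer_ext_ge0 andbT -ES0.
by apply: le_outer_ext; exact: setSI.
Qed.

(** With S n the set found for the piece D n, the union of the D n & S n
    differs from E only inside the union of the null sets D n & (E + S n). *)
Lemma sigma_finite_completion_fin_sub : sigma_finite_on A m ->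
  completion_measurable_fin A m `<=` completion_measurable A m.
Proof.
move=> [D [Dfin _ DT]] E ME.
have /choice[S SE] n : exists S, <<s A >> S /\ ext_dist A m (D n) E S = 0.
  by have [S] := ME _ (Dfin n); exists S.
exists (\bigcup_n (D n `&` S n)).
  apply: sigma_algebra_bigcup => n; apply: sigma_setI; last by case: (SE n).
  by apply: sub_sigma_algebra; case: (Dfin n).
apply/eqP; rewrite eq_le outer_ext_ge0 andbT.
rewrite -(@eseries0 R (fun n => ext_dist A m (D n) E (S n)) 0 xpredT); last first.
  by move=> n _ _; case: (SE n).
apply: le_trans (outer_ext_sigma_subadditive _).
apply: le_outer_ext => x [_ [[Ex nSx]|[[n _ [Dx Sx]] nEx]]].
  have [n _ Dx] : (\bigcup_n D n) x by rewrite DT.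
  exists n => //; split=> //; left; split=> // Sx.
  by apply: nSx; exists n.
by exists n => //; split=> //; right.
Qed.

End outer_measure_of_algebra.

Theorem theorem1p4 (R : realType) (X : Type) (A : set (set X))
    (m : set X -> \bar R) (hA : algebra_of_sets A) (hm : measure_on A m) :
  [/\ completion_measurable A m `<=` completion_measurable_fin A m,
      completion_measurable_fin A m = approx_measurable A m,
      approx_measurable A m = cara_measurable A m &
      cara_measurable A m = cara_measurable_fin A m] /\
  (sigma_finite_on A m ->
   [/\ completion_measurable A m = completion_measurable_fin A m,
       completion_measurable_fin A m = approx_measurable A m,
       approx_measurable A m = cara_measurable A m &
       cara_measurable A m = cara_measurable_fin A m]).
Proof.
have CaE := cara_measurable_finE R X A m hA hm.
have MCa : approx_measurable A m = cara_measurable A m.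
  apply/seteqP; split; last exact: cara_sub_approx.
  by rewrite CaE; exact: approx_sub_cara_fin.
have CoM : completion_measurable_fin A m = approx_measurable A m.
  rewrite MCa; apply/seteqP; split; last exact: cara_sub_completion_fin.
  by rewrite CaE; exact: completion_fin_sub_cara_fin.
have CoCo := completion_sub_completion_fin R X A m hm.
split=> // sfin; split=> //; apply/seteqP; split=> //.
exact: sigma_finite_completion_fin_sub.
Qed.
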